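(* Let $\mathcal A=\{h_1,\dots,h_6\}$ be the arrangement in $\mathbb R^3$ of the planes spanned by the six faces of a cube, labelled so that $h_i$ and $h_{i+3}$ are opposite faces for $i=1,2,3$, and let $V_q$ be its $27\times27$ $q$-Varchenko matrix, with the regions ordered as in the context. Then the Smith normal form of $V_q$ over $\mathbb Z[q]$ is $$\mathrm{diag}\big(1,\ (1-q^2)I_6,\ (1-q^2)^2I_{12},\ (1-q^2)^3I_8\big),$$ with left transition matrix $U$ and right transition matrix $U^t$, i.e. $UV_qU^t$ equals this diagonal matrix, where, with block sizes $1,6,6,6,6,2$, $$U=\begin{pmatrix}1&0&0&0&0&0\\ -q\mathbf 1&I_6&0&0&0&0\\ q^2\mathbf 1&-q(I+J)&I_6&0&0&0\\ q^2\mathbf 1&-q(I+J^2)&0&I_6&0&0\\ -q^3\mathbf 1&q^2(I+J+J^2)&-q(I+J)&-qI&I_6&0\\ -q^3\mathbf 1&q^2(I_2|I_2|I_2)&0&-q(I_2|I_2|I_2)&0&I_2\end{pmatrix}.$$ Here $\mathbf 1$ denotes a column of ones of the appropriate length, $I=I_6$, $(I_2|I_2|I_2)$ is the $2\times6$ matrix formed by three copies of $I_2$, and $J$ is the $6\times6$ permutation matrix with $J_{r,r+1}=1$ for $1\le r\le5$, $J_{6,1}=1$ and all other entries $0$.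
   Context: For a hyperplane arrangement, the regions are the connected components of the complement of the union of the hyperplanes; $sep(R,R')$ is the set of hyperplanes separating $R$ from $R'$. The $q$-Varchenko matrix $V_q$ is indexed by the regions, with $(R,R')$-entry $q^{\#sep(R,R')}$. $R_0$ is the interior of the cube. A region $R$ is denoted by the string of indices of the planes in $sep(R_0,R)$ (with $0$ denoting $R_0$). The 27 regions, in order, are: $0$; $1,2,3,4,5,6$; $12,23,34,45,56,61$; $13,24,35,46,15,26$; $123,234,345,456,561,612$; $135,246$. A Smith normal form over $\mathbb Z[q]$ of an $m\times m$ matrix $M$ over $\mathbb Z[q]$ is a diagonal matrix $D=\mathrm{diag}(d_1,\dots,d_m)$ with $d_k\mid d_{k+1}$ in $\mathbb Z[q]$ for all $k$ and $D=AMB$ with $A,B\in GL_m(\mathbb Z[q])$; $A$ and $B$ are the left and right transition matrices. *)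

(* Defs.v *)
From HB Require Import structures.
From mathcomp Require Import all_boot all_order all_algebra.
From mathcomp Require Import all_classical all_reals all_analysis.
Set Implicit Arguments.
Unset Strict Implicit.
Unset Printing Implicit Defensive.
Import Order.TTheory GRing.Theory Num.Theory.
Import numFieldNormedType.Exports.
Local Open Scope classical_set_scope.
Local Open Scope ring_scope.

Section Arrangement.
Context {R : realType} {n : nat} {I : finType}.
Implicit Types (H A B : set 'rV[R]_n) (h : I -> set 'rV[R]_n).

Definition dotp (v x : 'rV[R]_n) : R := (x *m v^T) 0 0.

Definition complement h : set 'rV[R]_n := ~` (\bigcup_i h i).

Definition regions h : set (set 'rV[R]_n) :=
  [set connected_component (complement h) x | x in complement h].

(* [H] is a hyperplane with [A] and [B] in opposite open half-spaces; the two
   sides may be swapped by replacing [(v, d)] with [(- v, - d)]. *)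
Definition separates H A B : Prop :=
  exists (v : 'rV[R]_n) (d : R),
    [/\ v != 0, H = [set x | dotp v x = d],
        A `<=` [set x | dotp v x < d] & B `<=` [set x | d < dotp v x]].

(* The separating hyperplanes are recorded by their indices, which counts them
   correctly as soon as [h] is injective. *)
Definition sep h A B : {set I} := [set i | `[< separates (h i) A B >]]%SET.

Definition varchenko_mx m h (r : 'I_m -> set 'rV[R]_n) : 'M[{poly int}]_m :=
  \matrix_(k, l) 'X ^+ #|sep h (r k) (r l)|.

Definition affine_span A : set 'rV[R]_n :=
  [set y | exists m (x : 'I_m -> 'rV[R]_n) (t : 'I_m -> R),
    [/\ forall k, A (x k), \sum_k t k = 1 & y = \sum_k t k *: x k]].

End Arrangement.

Section Cube.
Context {R : realType}.
Variables (c : 'rV[R]_3) (u : 'M[R]_3) (a : R).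

(* The cube with centre [c] and half side length [a] whose edge directions are
   the rows of [u]; it is a cube when [u] is orthogonal and [0 < a]. *)
Definition cube : set 'rV[R]_3 :=
  [set x | forall j, `|dotp (row j u) (x - c)| <= a].

Definition cube_face (f : 'I_3 * bool) : set 'rV[R]_3 :=
  [set x | cube x /\ dotp (row f.1 u) (x - c) = (-1) ^+ f.2 * a].

Definition opposite_face (f : 'I_3 * bool) : 'I_3 * bool := (f.1, ~~ f.2).

(* [h] lists the planes spanned by the six faces, the plane h_i of the usual
   1-based numbering being [h (i - 1)]. *)
Definition cube_arrangement (h : 'I_6 -> set 'rV[R]_3) : Prop :=
  exists f : 'I_6 -> 'I_3 * bool,
    [/\ bijective f,
        forall i, h i = affine_span (cube_face (f i)) &
        forall i j : 'I_6, j = (i + 3)%N :> nat -> f j = opposite_face (f i)].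

End Cube.

(* Strings are lists of 1-based plane indices; the string 0 is the empty list. *)
Definition region_strings : seq (seq nat) :=
  [:: [::];
      [:: 1]; [:: 2]; [:: 3]; [:: 4]; [:: 5]; [:: 6];
      [:: 1; 2]; [:: 2; 3]; [:: 3; 4]; [:: 4; 5]; [:: 5; 6]; [:: 6; 1];
      [:: 1; 3]; [:: 2; 4]; [:: 3; 5]; [:: 4; 6]; [:: 1; 5]; [:: 2; 6];
      [:: 1; 2; 3]; [:: 2; 3; 4]; [:: 3; 4; 5];
      [:: 4; 5; 6]; [:: 5; 6; 1]; [:: 6; 1; 2];
      [:: 1; 3; 5]; [:: 2; 4; 6]]%N.

Definition region_label (k : 'I_27) : {set 'I_6} :=
  [set i : 'I_6 | i.+1 \in nth [::] region_strings k]%SET.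

Definition region_order {R : realType} (h : 'I_6 -> set 'rV[R]_3)
    (R0 : set 'rV[R]_3) (r : 'I_27 -> set 'rV[R]_3) : Prop :=
  [/\ set_bij setT (regions h) r, r ord0 = R0 &
      forall k, sep h R0 (r k) = region_label k].

(* Divisibility in Z[q] is spelled out: [%|] on [{poly int}] only tests
   pseudo-divisibility, so that, e.g., [2%:P %| 'X] holds. *)
Definition Zq_dvd (d e : {poly int}) : Prop := exists s, e = s * d.

Definition smith_normal_form m (M D A B : 'M[{poly int}]_m) : Prop :=
  [/\ is_diag_mx D,
      forall k l : 'I_m, l = k.+1 :> nat -> Zq_dvd (D k k) (D l l),
      A \in unitmx, B \in unitmx & D = A *m M *m B].

Local Notation q := ('X : {poly int}).

Definition J : 'M[{poly int}]_6 := \matrix_(r, s) (s == ordS r)%:R.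

Definition I2I2I2 : 'M[{poly int}]_(2, 6) := row_mx 1%:M (row_mx 1%:M 1%:M).

Definition block_row m
    (A1 : 'M[{poly int}]_(m, 1)) (A2 A3 A4 A5 : 'M[{poly int}]_(m, 6))
    (A6 : 'M[{poly int}]_(m, 2)) : 'M[{poly int}]_(m, 27) :=
  row_mx A1 (row_mx A2 (row_mx A3 (row_mx A4 (row_mx A5 A6)))).

Definition transition_mx : 'M[{poly int}]_27 :=
  let I : 'M[{poly int}]_6 := 1%:M in
  col_mx (block_row 1%:M 0 0 0 0 0)
 (col_mx (block_row (const_mx (- q)) I 0 0 0 0)
 (col_mx (block_row (const_mx (q ^+ 2)) (- q *: (I + J)) I 0 0 0)
 (col_mx (block_row (const_mx (q ^+ 2)) (- q *: (I + J ^+ 2)) 0 I 0 0)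
 (col_mx (block_row (const_mx (- q ^+ 3)) (q ^+ 2 *: (I + J + J ^+ 2))
            (- q *: (I + J)) (- q *: I) I 0)
         (block_row (const_mx (- q ^+ 3)) (q ^+ 2 *: I2I2I2)
            0 (- q *: I2I2I2) 0 1%:M))))).

Definition diagonal_form : 'M[{poly int}]_27 :=
  block_mx (1%:M : 'M[{poly int}]_1) 0 0
 (block_mx ((1 - q ^+ 2)%:M : 'M[{poly int}]_6) 0 0
 (block_mx (((1 - q ^+ 2) ^+ 2)%:M : 'M[{poly int}]_12) 0 0
           (((1 - q ^+ 2) ^+ 3)%:M : 'M[{poly int}]_8))).

(* Main.v *)
Require Import Defs.
From mathcomp Require Import all_boot all_order all_algebra.
From mathcomp Require Import all_classical all_reals all_analysis.
From mathcomp Require Import ring lra.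
Set Implicit Arguments.
Unset Strict Implicit.
Unset Printing Implicit Defensive.
Import Order.TTheory GRing.Theory Num.Theory.
Import numFieldNormedType.Exports.
Local Open Scope classical_set_scope.
Local Open Scope ring_scope.

(** Identify a region with the set of planes separating it from the interior of
    the cube: the regions become the 27 sets S of planes without opposite pair,
    and the matrix entry at (S, T) is q^|S + T| (symmetric difference).  The
    entry of U at (S, T) is (-q)^|S \ T| if T is a subset of S, and 0 otherwise.
    As the admissible sets are closed under subsets, the sums in U V U^t run
    over full powersets, hence factor over the planes:
      (U V)(S, T) = [S <= T] (1 - q^2)^|S| q^|T \ S|,
      (U V U^t)(S, T) = [S = T] (1 - q^2)^|S|.
    On the geometric side, a set of points with prescribed signs with respect to
    the planes is convex, hence is a connected component of the complement as
    soon as it is nonempty; and a plane separates two such cells exactly when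
    the prescribed signs differ, since otherwise a segment between the cells
    would cross the plane. *)

(** * Sums over powersets *)

Section SubsetSums.
Context {A : comPzRingType} {I : finType}.
Implicit Types (q : A) (B S T M : {set I}).

Definition symdiff S T : {set I} := ((S :\: T) :|: (T :\: S))%SET.

Lemma expr_card_prod B q : q ^+ #|B| = \prod_i (if i \in B then q else 1).
Proof. by rewrite -prodr_const big_mkcond. Qed.

(** Expanding the product, [T] records where the first summand is chosen; a [T] not inside [S] picks
    up a factor 0. *)
Lemma sum_subset_prod S (F G : I -> A) :
  \sum_(T : {set I} | T \subset S)
     \prod_i (if i \in T then F i else G i) =
  \prod_i ((if i \in S then F i else 0) + G i).
Proof.
rewrite bigA_distr /= [RHS](bigID (fun T : {set I} => T \subset S)) /=.
rewrite [X in _ = _ + X]big1 ?addr0 => [|T /subsetPn[i iT iS]].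
  apply: eq_bigr => T /fintype.subsetP sTS; apply: eq_bigr => i _.
  by case: ifP => // /sTS ->.
by rewrite (bigD1 i) //= iT (negbTE iS) mul0r.
Qed.

(** The factor at a plane is 1 - q^2 on S ∩ M, q - q = 0 on S \ M, q on M \ S and 1 elsewhere. *)
Lemma sum_subset_symdiff S M q :
  \sum_(T : {set I} | T \subset S)
     (- q) ^+ #|(S :\: T)%SET| * q ^+ #|symdiff T M| =
  if S \subset M then (1 - q ^+ 2) ^+ #|S| * q ^+ #|(M :\: S)%SET| else 0.
Proof.
pose F i := if i \in M then 1 else q.
pose G i := (if i \in S then - q else 1) * (if i \in M then q else 1).
transitivity (\sum_(T : {set I} | T \subset S)
                 \prod_i (if i \in T then F i else G i)).
  apply: eq_bigr => T sTS; rewrite !expr_card_prod -big_split /=.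
  apply: eq_bigr => i _; rewrite /F /G !inE; have := fintype.subsetP sTS i.
  by case: (i \in T) => [->//|_]; case: (i \in M); rewrite /= ?mul1r.
rewrite sum_subset_prod; case: ifPn => [sSM|/subsetPn[i iS iM]].
  rewrite !expr_card_prod -big_split /=; apply: eq_bigr => i _.
  rewrite /F /G !inE; have := fintype.subsetP sSM i.
  case: (i \in S) => [->//|_] /=.
    by rewrite mulNr mulr1 expr2.
  by rewrite add0r.
by rewrite (bigD1 i) //= iS /F /G iS (negbTE iM) mulr1 subrr mul0r.
Qed.

(** The factor at a plane is 0 on S \ M, q - q = 0 on M \ S and 1 elsewhere, so only S = M
    survives. *)
Lemma sum_subset_subset S M q :
  \sum_(T : {set I} | T \subset M)
     (if S \subset T then q ^+ #|(T :\: S)%SET| else 0)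
       * (- q) ^+ #|(M :\: T)%SET| = (S == M)%:R.
Proof.
pose F i := if i \in S then 1 else q.
(* The value 0 on [S] kills every [T] that does not contain [S]. *)
pose G i := if i \in S then 0 else if i \in M then - q else 1.
transitivity (\sum_(T : {set I} | T \subset M)
                 \prod_i (if i \in T then F i else G i)).
  apply: eq_bigr => T sTM; case: ifPn => [sST|/subsetPn[i iS iT]]; last first.
    by rewrite mul0r (bigD1 i) //= (negbTE iT) /G iS mul0r.
  rewrite !expr_card_prod -big_split /=.
  apply: eq_bigr => i _; rewrite /F /G !inE.
  have := fintype.subsetP sTM i; have := fintype.subsetP sST i.
  case: (i \in T) => /=.
    by rewrite andbT mulr1; case: (i \in S).
  case: (i \in S) => [/(_ isT)//|] _ _.
  by rewrite mul1r.
rewrite sum_subset_prod; case: eqVneq => [eqSM|/eqP neqSM].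
  rewrite big1 // => i _; rewrite /F /G -eqSM.
  by case: (i \in S); rewrite ?addr0 ?add0r.
have [i iP] : exists i, (i \in S) != (i \in M).
  apply/existsP; rewrite -negb_forall; apply/negP => /forallP eqSM.
  by apply: neqSM; apply/setP => i; apply/eqP.
rewrite (bigD1 i) //= /F /G; move: iP.
by case: (i \in S); case: (i \in M) => // _; rewrite ?addr0 ?subrr mul0r.
Qed.

End SubsetSums.

(** * The transition and diagonal matrices *)

Local Notation q := ('X : {poly int}).

(* [k] indexes [region_strings] and [i] is a 0-based plane index. *)
Definition label_mem (k i : nat) : bool := i.+1 \in nth [::] region_strings k.

Definition label_incl (k l : nat) : bool :=
  all (fun i => label_mem k i ==> label_mem l i) (iota 0 6).

Definition label_size (k : nat) : nat := count (label_mem k) (iota 0 6).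

Lemma forall_ordE n (P : pred nat) : [forall i : 'I_n, P i] = all P (iota 0 n).
Proof.
apply/forallP/allP => [Pn i|Pn i].
  by rewrite mem_iota => /= ltin; apply: (Pn (Ordinal ltin)).
by apply: Pn; rewrite mem_iota /=.
Qed.

Lemma region_label_subset k l :
  (region_label k \subset region_label l) = label_incl k l.
Proof.
rewrite /label_incl -forall_ordE.
apply/fintype.subsetP/forallP => [sub i|sub i].
  by apply/implyP; have := sub i; rewrite !inE.
by rewrite !inE => ik; apply: (implyP (sub i)).
Qed.

Lemma card_region_label k : #|region_label k| = label_size k.
Proof.
rewrite -sum1_card /label_size -sum1_count.
rewrite -[iota 0 6]/(index_iota 0 6) big_mkord.
by apply: eq_bigl => i; rewrite inE.
Qed.

(** Turns a statement about all pairs of ordinals into a boolean test over lists of numbers, which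
    [vm_compute] can evaluate. *)
Lemma all_ord2 (P : nat -> nat -> bool) n m :
  all (fun k => all (P k) (iota 0 m)) (iota 0 n) ->
  forall (k : 'I_n) (l : 'I_m), P k l.
Proof.
by move=> Pall k l; apply: (allP (allP Pall k _));
  rewrite mem_iota add0n ltn_ord.
Qed.

Lemma region_label_inj : injective region_label.
Proof.
move=> k l eq_kl; apply/val_inj/eqP.
have : label_incl k l && label_incl l k.
  by rewrite -!region_label_subset eq_kl subxx.
apply: implyP; move: k l {eq_kl}.
apply: (@all_ord2
  (fun k l => label_incl k l && label_incl l k ==> (k == l))).
by vm_compute.
Qed.

Lemma J_mx (r s : 'I_6) : J r s = ((s : nat) == r.+1 %% 6)%N%:R.
Proof. by rewrite mxE. Qed.

Lemma J2_mx (r s : 'I_6) : (J ^+ 2) r s = ((s : nat) == r.+2 %% 6)%N%:R.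
Proof.
rewrite expr2 -[J * J]/(J *m J) mxE (bigD1 (ordS r)) //= big1 ?addr0.
  by rewrite !mxE eqxx mul1r -val_eqE /= -[(r.+1 %% 6)%N.+1]addn1 modnDml addn1.
by move=> i /negbTE neq; rewrite mxE neq mul0r.
Qed.

Lemma I2I2I2_mx (r : 'I_2) (s : 'I_6) : I2I2I2 r s = ((s %% 2)%N == r)%:R.
Proof.
rewrite /I2I2I2; case: (@split_ordP 2 4 s) => i ->.
  by rewrite (@row_mxEl _ 2 2 4) !mxE eq_sym -val_eqE /= modn_small.
rewrite (@row_mxEr _ 2 2 4); case: (@split_ordP 2 2 i) => j ->.
  by rewrite (@row_mxEl _ 2 2 2) !mxE eq_sym -val_eqE /= modnDl modn_small.
by rewrite (@row_mxEr _ 2 2 2) !mxE eq_sym -val_eqE /= !modnDl modn_small.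
Qed.

(** Plain numbers as indices allow block offsets to be added; under inclusion the difference of
    sizes is the size of the set difference. *)
Definition transition_entry (k l : nat) : {poly int} :=
  if label_incl l k then (- q) ^+ (label_size k - label_size l) else 0.

(* [r] and [c] are the offsets of the block [B] in [transition_mx]. *)
Definition block_spec m n (B : 'M[{poly int}]_(m, n)) (r c : nat) : Prop :=
  forall i j, B i j = transition_entry (r + i) (c + j).

(** All nonzero entries of a block carry the same power of -q. This leaves a common exponent [d] and
    a 0/1 pattern [x], both checked by computation. *)
Lemma block_specP m n (B : 'M[{poly int}]_(m, n)) r c d
    (x : nat -> nat -> nat) :
  (forall i j, B i j = (- q) ^+ d * (x i j)%:R) ->
  all (fun i => all (fun j =>
    let b := label_incl (c + j) (r + i) in
    (x i j == b) && (b ==> (label_size (r + i) - label_size (c + j) == d)%N))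
    (iota 0 n)) (iota 0 m) ->
  block_spec B r c.
Proof.
move=> defB chk i j; rewrite defB /transition_entry.
have /= := all_ord2 chk i j.
case: label_incl => /andP[/eqP->]; last by rewrite mulr0.
by move=> /eqP ->; rewrite mulr1.
Qed.

Lemma block_spec_row m
    (A1 : 'M[{poly int}]_(m, 1)) (A2 A3 A4 A5 : 'M[{poly int}]_(m, 6))
    (A6 : 'M[{poly int}]_(m, 2)) r :
  block_spec A1 r 0 -> block_spec A2 r 1 -> block_spec A3 r 7 ->
  block_spec A4 r 13 -> block_spec A5 r 19 -> block_spec A6 r 25 ->
  block_spec (block_row A1 A2 A3 A4 A5 A6) r 0.
Proof.
move=> e1 e2 e3 e4 e5 e6 i j; rewrite /block_row.
case: (@split_ordP 1 26 j) => {}j ->; first by rewrite (@row_mxEl _ m 1 26) e1.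
rewrite (@row_mxEr _ m 1 26); case: (@split_ordP 6 20 j) => {}j ->.
  by rewrite (@row_mxEl _ m 6 20) e2.
rewrite (@row_mxEr _ m 6 20); case: (@split_ordP 6 14 j) => {}j ->.
  by rewrite (@row_mxEl _ m 6 14) e3.
rewrite (@row_mxEr _ m 6 14); case: (@split_ordP 6 8 j) => {}j ->.
  by rewrite (@row_mxEl _ m 6 8) e4.
rewrite (@row_mxEr _ m 6 8); case: (@split_ordP 6 2 j) => {}j ->.
  by rewrite (@row_mxEl _ m 6 2) e5.
by rewrite (@row_mxEr _ m 6 2) e6.
Qed.

Lemma block_spec0 m n r c :
  all (fun i => all (fun j => ~~ label_incl (c + j) (r + i)) (iota 0 n))
    (iota 0 m) ->
  block_spec (0 : 'M[{poly int}]_(m, n)) r c.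
Proof.
move=> chk; apply: (@block_specP _ _ _ _ _ 0 (fun _ _ => 0%N)).
  by move=> i j; rewrite mxE mulr0.
apply: sub_all chk => i; apply: sub_all => j /negbTE /= ->.
by [].
Qed.

Lemma block_spec1 n r c :
  all (fun i => all (fun j => let b := label_incl (c + j) (r + i) in
    ((i == j) == b) && (b ==> (label_size (r + i) - label_size (c + j) == 0)%N))
    (iota 0 n)) (iota 0 n) ->
  block_spec (1%:M : 'M[{poly int}]_n) r c.
Proof.
move=> chk; apply: (@block_specP _ _ _ _ _ 0 (fun i j => i == j)).
  by move=> i j; rewrite mxE expr0 mul1r.
apply: sub_all chk => i; apply: sub_all => j /=.
by case: (i == j); case: label_incl.
Qed.

(** The block rows are treated in turn, at offsets 0, 1, 7, 13, 19, 25. In each nonzero block the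
    exponent is the difference between the label sizes of its rows and columns. *)
Lemma transition_mxE k l : transition_mx k l = transition_entry k l.
Proof.
move: l; rewrite /transition_mx.
case: (@split_ordP 1 26 k) => {}k -> l.
  rewrite (@col_mxEu _ 1 26 27); move: k l.
  apply: (@block_spec_row _ _ _ _ _ _ _ 0);
    try by apply: block_spec0; vm_compute.
  by apply: block_spec1; vm_compute.
rewrite (@col_mxEd _ 1 26 27); case: (@split_ordP 6 20 k) => {}k ->.
  rewrite (@col_mxEu _ 6 20 27); move: k l.
  apply: (@block_spec_row _ _ _ _ _ _ _ 1);
    try by apply: block_spec0; vm_compute.
    apply: (@block_specP _ _ _ _ _ 1 (fun i j => 1%N)); last by vm_compute.
    by move=> i j; rewrite mxE mulr1.
  by apply: block_spec1; vm_compute.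
rewrite (@col_mxEd _ 6 20 27); case: (@split_ordP 6 14 k) => {}k ->.
  rewrite (@col_mxEu _ 6 14 27); move: k l.
  apply: (@block_spec_row _ _ _ _ _ _ _ 7);
    try by apply: block_spec0; vm_compute.
  - apply: (@block_specP _ _ _ _ _ 2 (fun i j => 1%N)); last by vm_compute.
    by move=> i j; rewrite mxE mulr1 sqrrN.
  - apply: (@block_specP _ _ _ _ _ 1
      (fun i j => (i == j) + (j == i.+1 %% 6))%N); last by vm_compute.
    by move=> i j; rewrite 2!mxE J_mx mxE natrD.
  - by apply: block_spec1; vm_compute.
rewrite (@col_mxEd _ 6 14 27); case: (@split_ordP 6 8 k) => {}k ->.
  rewrite (@col_mxEu _ 6 8 27); move: k l.
  apply: (@block_spec_row _ _ _ _ _ _ _ 13);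
    try by apply: block_spec0; vm_compute.
  - apply: (@block_specP _ _ _ _ _ 2 (fun i j => 1%N)); last by vm_compute.
    by move=> i j; rewrite mxE mulr1 sqrrN.
  - apply: (@block_specP _ _ _ _ _ 1
      (fun i j => (i == j) + (j == i.+2 %% 6))%N); last by vm_compute.
    by move=> i j; rewrite 2!mxE J2_mx mxE natrD.
  - by apply: block_spec1; vm_compute.
rewrite (@col_mxEd _ 6 8 27); case: (@split_ordP 6 2 k) => {}k ->.
  rewrite (@col_mxEu _ 6 2 27); move: k l.
  apply: (@block_spec_row _ _ _ _ _ _ _ 19);
    try by apply: block_spec0; vm_compute.
  - apply: (@block_specP _ _ _ _ _ 3 (fun i j => 1%N)); last by vm_compute.
    by move=> i j; rewrite mxE mulr1 exprNn -signr_odd mulN1r.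
  - apply: (@block_specP _ _ _ _ _ 2
      (fun i j => (i == j) + (j == i.+1 %% 6) + (j == i.+2 %% 6))%N);
      last by vm_compute.
    by move=> i j; rewrite 3!mxE J2_mx J_mx mxE sqrrN !natrD.
  - apply: (@block_specP _ _ _ _ _ 1
      (fun i j => (i == j) + (j == i.+1 %% 6))%N); last by vm_compute.
    by move=> i j; rewrite 2!mxE J_mx mxE natrD.
  - apply: (@block_specP _ _ _ _ _ 1 (fun i j => i == j)); last by vm_compute.
    by move=> i j; rewrite 2!mxE.
  - by apply: block_spec1; vm_compute.
rewrite (@col_mxEd _ 6 2 27); move: k l.
apply: (@block_spec_row _ _ _ _ _ _ _ 25);
  try by apply: block_spec0; vm_compute.
- apply: (@block_specP _ _ _ _ _ 3 (fun i j => 1%N)); last by vm_compute.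
  by move=> i j; rewrite mxE mulr1 exprNn -signr_odd mulN1r.
- apply: (@block_specP _ _ _ _ _ 2 (fun i j => (j %% 2)%N == i));
    last by vm_compute.
  by move=> i j; rewrite mxE I2I2I2_mx sqrrN.
- apply: (@block_specP _ _ _ _ _ 1 (fun i j => (j %% 2)%N == i));
    last by vm_compute.
  by move=> i j; rewrite mxE I2I2I2_mx.
- by apply: block_spec1; vm_compute.
Qed.

Definition diagonal_spec n (B : 'M[{poly int}]_n) (r : nat) : Prop :=
  forall i j, B i j = ((1 - q ^+ 2) ^+ label_size (r + i)) *+ (i == j).

Lemma diagonal_spec_scalar n r d :
  all (fun i => label_size (r + i) == d) (iota 0 n) ->
  diagonal_spec (((1 - q ^+ 2) ^+ d)%:M : 'M[{poly int}]_n) r.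
Proof.
rewrite -forall_ordE => /forallP size_d i j.
by rewrite mxE (eqP (size_d i)).
Qed.

Lemma diagonal_spec_block m n (A : 'M[{poly int}]_m) (B : 'M[{poly int}]_n) r :
  diagonal_spec A r -> diagonal_spec B (r + m) ->
  diagonal_spec (block_mx A 0 0 B) r.
Proof.
move=> dA dB i j.
case: (split_ordP i) => {}i ->; case: (split_ordP j) => {}j ->.
- by rewrite block_mxEul dA eq_lshift.
- by rewrite block_mxEur mxE eq_lrshift.
- by rewrite block_mxEdl mxE eq_rlshift.
- by rewrite block_mxEdr dB eq_rshift addnA.
Qed.

Lemma diagonal_formE k l :
  diagonal_form k l = ((1 - q ^+ 2) ^+ label_size k) *+ (k == l).
Proof.
(* Restating the dimension as a nested sum exposes the block structure to [diagonal_spec_block]. *)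
suff: diagonal_spec (diagonal_form : 'M[{poly int}]_(1 + (6 + (12 + 8)))) 0 by apply.
rewrite /diagonal_form; apply: diagonal_spec_block.
  by rewrite -(expr0 (1 - q ^+ 2)); apply: diagonal_spec_scalar; vm_compute.
apply: diagonal_spec_block.
  rewrite -(expr1 (1 - q ^+ 2)); apply: diagonal_spec_scalar; by vm_compute.
by apply: diagonal_spec_block; apply: diagonal_spec_scalar; vm_compute.
Qed.

(** * Sets of planes without an opposite pair *)

Definition antipode (i : 'I_6) : 'I_6 := inord ((i + 3) %% 6)%N.

Lemma antipodeE i : antipode i = ((i + 3) %% 6)%N :> nat.
Proof. by rewrite inordK // ltn_mod. Qed.

Definition antipode_free (T : {set 'I_6}) : Prop :=
  forall i, i \in T -> antipode i \notin T.

Lemma region_label_antipode_free k : antipode_free (region_label k).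
Proof.
move=> i; rewrite !inE antipodeE; apply/implyP; move: k i.
apply: (@all_ord2 (fun k i => label_mem k i ==>
  ~~ label_mem k ((i + 3) %% 6)%N)).
by vm_compute.
Qed.

(** A set is encoded by six bits. With injectivity, this makes the 27 strings an enumeration of the
    antipode-free sets. *)
Lemma region_label_surj T : antipode_free T -> exists k, region_label k = T.
Proof.
move=> freeT.
pose b (i : nat) : bool := (inord i : 'I_6) \in T.
have bE (i : 'I_6) : (i \in T) = b i by rewrite /b inord_val.
have free i : (i < 6)%N -> b i -> ~~ b ((i + 3) %% 6)%N.
  by move=> lti6 /freeT; rewrite /antipode inordK.
have [k ltk kP] : exists2 k, (k < 27)%N &
    [&& label_mem k 0 == b 0%N, label_mem k 1 == b 1%N,
        label_mem k 2 == b 2%N, label_mem k 3 == b 3%N,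
        label_mem k 4 == b 4%N & label_mem k 5 == b 5%N].
  have := free 0%N isT; have := free 1%N isT; have := free 2%N isT.
  rewrite -[((0 + 3) %% 6)%N]/3%N -[((1 + 3) %% 6)%N]/4%N
    -[((2 + 3) %% 6)%N]/5%N.
  move: (b 0%N) (b 1%N) (b 2%N) (b 3%N) (b 4%N) (b 5%N).
  move=> b0 b1 b2 b3 b4 b5 f2 f1 f0.
  suff /hasP[k] : has (fun k =>
      [&& label_mem k 0 == b0, label_mem k 1 == b1, label_mem k 2 == b2,
          label_mem k 3 == b3, label_mem k 4 == b4 & label_mem k 5 == b5])
      (iota 0 27).
    by rewrite mem_iota => ltk kP; exists k.
  (* In each case either a string with these bits is found by computation or two opposite bits are
     both set, against [f0], [f1] or [f2]. *)
  by case: b0 f0 => f0; case: b1 f1 => f1; case: b2 f2 => f2;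
    case: b3 f0 => f0; case: b4 f1 => f1; case: b5 f2 => f2;
    first [by vm_compute | by have := f0 isT | by have := f1 isT
          | by have := f2 isT].
exists (Ordinal ltk); apply/setP => i; rewrite inE bE; apply/eqP.
case/and5P: kP => k0 k1 k2 k3 /andP[k4 k5].
by case: i => [[|[|[|[|[|[|]]]]]]].
Qed.

(** * The product U V U^t *)

Lemma transition_mx_label k l :
  transition_mx k l =
  if region_label l \subset region_label k
  then (- q) ^+ #|(region_label k :\: region_label l)%SET| else 0.
Proof.
rewrite transition_mxE /transition_entry region_label_subset.
case: ifPn => // incl; rewrite cardsD !card_region_label.
by rewrite (finset.setIidPr _) ?card_region_label // region_label_subset.
Qed.

(** Every subset of a label is again a label, so a sum along a row of U runs over a full
    powerset. *)
Lemma transition_sum k (F : {set 'I_6} -> {poly int}) :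
  \sum_l transition_mx k l * F (region_label l) =
  \sum_(T : {set 'I_6} | T \subset region_label k)
    (- q) ^+ #|(region_label k :\: T)%SET| * F T.
Proof.
(* [g] inverts [region_label]; the default [ord0] is never reached on subsets of a label. *)
pose g T := odflt ord0 [pick l | region_label l == T].
have gK l : g (region_label l) = l.
  rewrite /g; case: pickP => [m /eqP /region_label_inj //|/(_ l)].
  by rewrite eqxx.
rewrite [RHS](reindex_onto region_label g); last first.
  move=> T sTk; have [|l <-] := @region_label_surj T; last by rewrite gK.
  move=> i iT; apply: contra (region_label_antipode_free _); last first.
    exact: (fintype.subsetP sTk i iT).
  exact: (fintype.subsetP sTk).
rewrite [RHS]big_mkcond; apply: eq_bigr => l _.
by rewrite transition_mx_label gK eqxx andbT; case: ifP; rewrite ?mul0r.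
Qed.

(** No label is contained in an earlier one, so the matrix is lower triangular, with diagonal
    entries (-q)^0 = 1. *)
Lemma transition_mx_unit : transition_mx \in unitmx.
Proof.
rewrite unitmxE det_trig; last first.
  apply/is_trig_mxP => i j ltij; rewrite transition_mxE /transition_entry.
  suff /negbTE-> : ~~ label_incl j i by [].
  move: ltij; apply/implyP; move: i j.
  apply: (@all_ord2 (fun i j => (i < j)%N ==> ~~ label_incl j i)).
  by vm_compute.
rewrite big1 ?unitr1 // => i _.
by rewrite transition_mx_label subxx finset.setDv cards0.
Qed.

(** The algebraic half of the theorem: the geometry enters only through the hypothesis on the
    entries of [V]. *)
Lemma smith_normal_form_label (V : 'M[{poly int}]_27) :
  (forall k l, V k l = q ^+ #|symdiff (region_label k) (region_label l)|) ->
  smith_normal_form V diagonal_form transition_mx transition_mx^T.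
Proof.
move=> VE; split.
- apply/is_diag_mxP => i j /negbTE neq.
  by rewrite diagonal_formE -val_eqE neq.
- move=> k l lk; rewrite !diagonal_formE !eqxx.
  (* Label sizes never decrease along the list, so this exponent is a genuine difference. *)
  exists ((1 - q ^+ 2) ^+ (label_size l - label_size k)).
  rewrite -exprD subnK //.
  move: lk => /eqP; apply/implyP; move: k l.
  apply: (@all_ord2 (fun k l => (l == k.+1) ==>
    (label_size k <= label_size l)%N)).
  by vm_compute.
- exact: transition_mx_unit.
- by rewrite unitmx_tr transition_mx_unit.
apply/matrixP => k m; rewrite diagonal_formE [RHS]mxE.
(* [F] is the closed form of the entries of U V. *)
pose F (S T : {set 'I_6}) : {poly int} := if S \subset T
  then (1 - q ^+ 2) ^+ #|S| * q ^+ #|(T :\: S)%SET| else 0.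
transitivity (\sum_l transition_mx m l *
    F (region_label k) (region_label l)); last first.
  apply: eq_bigr => l _; rewrite mulrC [transition_mx^T _ _]mxE.
  congr (_ * _); rewrite mxE /F -sum_subset_symdiff.
  rewrite -(transition_sum k (fun T => q ^+ #|symdiff T (region_label l)|)).
  by apply: eq_bigr => j _; rewrite VE.
rewrite (transition_sum m (F (region_label k))) -card_region_label.
rewrite -(inj_eq region_label_inj) -mulr_natr -(sum_subset_subset _ _ q).
rewrite big_distrr; apply: eq_bigr => T _ /=; rewrite /F mulrC.
case: ifP => _; last by rewrite !mul0r mulr0.
by rewrite -mulrA mulrC -mulrA.
Qed.

(** * Regions of a hyperplane arrangement *)

Section DotProduct.
Context {R : realType} {n : nat}.
Implicit Types (v w x y : 'rV[R]_n) (a t : R).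

Lemma dotpE v x : dotp v x = \sum_j x 0 j * v 0 j.
Proof. by rewrite /dotp mxE; apply: eq_bigr => j _; rewrite mxE. Qed.

Lemma dotpDr v x y : dotp v (x + y) = dotp v x + dotp v y.
Proof. by rewrite /dotp mulmxDl mxE. Qed.

Lemma dotpNr v x : dotp v (- x) = - dotp v x.
Proof. by rewrite /dotp mulNmx mxE. Qed.

Lemma dotpNl v x : dotp (- v) x = - dotp v x.
Proof. by rewrite /dotp linearN mulmxN mxE. Qed.

Lemma dotpZr v a x : dotp v (a *: x) = a * dotp v x.
Proof. by rewrite /dotp -scalemxAl mxE. Qed.

Lemma dotpZl a v x : dotp (a *: v) x = a * dotp v x.
Proof. by rewrite /dotp linearZ -scalemxAr mxE. Qed.

Lemma dotp_sumr v m (x : 'I_m -> 'rV[R]_n) :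
  dotp v (\sum_k x k) = \sum_k dotp v (x k).
Proof. by rewrite /dotp mulmx_suml summxE. Qed.

Lemma dotp_gt0 v : v != 0 -> 0 < dotp v v.
Proof.
move=> v0; rewrite dotpE lt_def; apply/andP; split; last first.
  by apply: sumr_ge0 => j _; rewrite -expr2 sqr_ge0.
apply: contra v0 => /eqP/psumr_eq0P v0; apply/eqP/rowP => j; rewrite mxE.
have /eqP := v0 (fun j _ => sqr_ge0 (v 0 j)) j isT.
by rewrite mulf_eq0 orbb => /eqP.
Qed.

Lemma dotp_continuous v : continuous (dotp v).
Proof.
rewrite (_ : dotp v = fun x => \sum_j x 0 j * v 0 j); last first.
  by apply/funext => x; rewrite dotpE.
apply: continuous_big; first exact: add_continuous.
move=> j _ x.
apply: (continuous_comp (f := fun x : 'rV[R]_n => x 0 j)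
  (g := *%R^~ (v 0 j))).
  exact: coord_continuous.
exact: mulrr_continuous.
Qed.

Definition segment x y t := x + t *: (y - x).

Lemma segment_continuous x y : continuous (segment x y).
Proof.
by move=> t; apply: cvgD; [exact: cvg_cst|exact: scalel_continuous].
Qed.

Lemma dotp_segment v x y t :
  dotp v (segment x y t) = dotp v x + t * (dotp v y - dotp v x).
Proof. by rewrite /segment dotpDr dotpZr dotpDr dotpNr. Qed.

End DotProduct.

Lemma convex_comb_gt (R : realDomainType) (a b1 b2 t : R) :
  0 <= t <= 1 -> a < b1 -> a < b2 -> a < b1 + t * (b2 - b1).
Proof. by move=> /andP[t0 t1] ab1 ab2; case: (lerP b1 b2) => b12; nra. Qed.

Lemma convex_comb_lt (R : realDomainType) (a b1 b2 t : R) :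
  0 <= t <= 1 -> b1 < a -> b2 < a -> b1 + t * (b2 - b1) < a.
Proof. by move=> /andP[t0 t1] ab1 ab2; case: (lerP b1 b2) => b12; nra. Qed.

(** * Cells given by sign patterns, and the regions *)

Section Cells.
Context {R : realType} {n : nat} {I : finType}.
Variables (v : I -> 'rV[R]_n) (d : I -> R).
Implicit Types (x y : 'rV[R]_n) (S T : {set I}).

Definition plane (i : I) : set 'rV[R]_n := [set x | dotp (v i) x = d i].

(** [T] lists the planes on whose positive side the points lie; the cell may be empty. *)
Definition cell T : set 'rV[R]_n :=
  [set x | forall i, if i \in T then d i < dotp (v i) x else dotp (v i) x < d i].

Definition sign_set x : {set I} := [set i | d i < dotp (v i) x]%SET.

Lemma cell_sign_set T x : cell T x -> sign_set x = T.
Proof.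
move=> Tx; apply/setP => i; rewrite inE; have := Tx i.
by case: ifP => // _ /ltW; rewrite leNgt => /negbTE.
Qed.

Lemma cell_complement T x : cell T x -> complement plane x.
Proof.
move=> Tx [i _]; rewrite /plane /= => xi; have := Tx i.
by rewrite xi ltxx; case: ifP.
Qed.

Lemma complement_cell x : complement plane x -> cell (sign_set x) x.
Proof.
move=> Cx i; rewrite inE; case: ltgtP => // xi.
by case: Cx; exists i.
Qed.

Lemma cell_segment T x y t :
  0 <= t <= 1 -> cell T x -> cell T y -> cell T (segment x y t).
Proof.
move=> t01 Tx Ty i; have := Tx i; have := Ty i; rewrite dotp_segment.
by case: ifP => _ yi xi; [exact: convex_comb_gt|exact: convex_comb_lt].
Qed.

(** By convexity of the cell, the segment from [x] to [y] is a connected subset of the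
    complement. *)
Lemma cell_connected T x y :
  cell T x -> cell T y -> connected_component (complement plane) x y.
Proof.
move=> Tx Ty; set B := [set segment x y t | t in `[0, 1]].
have Bx : B x.
  by exists 0; rewrite /= ?in_itv /= ?lexx ?ler01 // /segment scale0r addr0.
suff : B `<=` connected_component (complement plane) x.
  by apply; exists 1; rewrite /= ?in_itv /= ?lexx ?ler01 // /segment scale1r
    addrC subrK.
apply: connected_component_max => //.
  move=> _ [t t01 <-]; rewrite /= in_itv /= in t01.
  exact: (cell_complement (cell_segment t01 Tx Ty)).
apply: connected_continuous_connected; first exact: segment_connected.
exact/continuous_subspaceT/segment_continuous.
Qed.

(** Intermediate values: the image of a component under a linear form is an interval, and it must
    avoid [d i]. *)
Lemma component_same_side i x y :
  connected_component (complement plane) x y ->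
  dotp (v i) x < d i -> ~ d i < dotp (v i) y.
Proof.
move=> xy xi yi; have Cx : complement plane x.
  by apply: contrapT => /connected_component_out C0; rewrite C0 in xy.
have /connected_intervalP itv : connected
    [set dotp (v i) z | z in connected_component (complement plane) x].
  apply: connected_continuous_connected; first exact: component_connected.
  exact/continuous_subspaceT/dotp_continuous.
have [|||z xz zi] := itv (dotp (v i) x) (dotp (v i) y) _ _ (d i).
- by exists x => //; exact: connected_component_refl.
- by exists y.
- by rewrite !ltW.
by apply: (connected_component_sub xz); exists i.
Qed.

Lemma component_cell x :
  complement plane x ->
  connected_component (complement plane) x = cell (sign_set x).
Proof.
move=> Cx; apply/seteqP; split=> [y xy i|y]; last first.
  exact: cell_connected (complement_cell Cx).
have := complement_cell Cx i.
have := complement_cell (connected_component_sub xy) i.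
case: (i \in sign_set x); case: ifP => // _ yi xi.
  by case: (component_same_side (connected_component_sym xy) yi).
by case: (component_same_side xy xi).
Qed.

Lemma regionsE : regions plane = [set cell T | T in [set T | cell T !=set0]].
Proof.
apply/seteqP; split=> [_ [x Cx <-]|_ [T [x Tx] <-]].
  exists (sign_set x); last by rewrite component_cell.
  by exists x; exact: complement_cell.
exists x; first exact: cell_complement Tx.
by rewrite component_cell ?(cell_sign_set Tx) //; exact: cell_complement Tx.
Qed.

Lemma sep_cell S T : (forall i, v i != 0) -> cell S !=set0 -> cell T !=set0 ->
  sep plane (cell S) (cell T) = symdiff S T.
Proof.
move=> v0 [x Sx] [y Ty]; apply/setP => i; rewrite !inE; apply/asboolP/idP.
  (* The separating equation [(w, e)] may differ from [(v i, d i)]. The segment from [x] to [y]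
     crosses the plane at parameter [t], yet if the signs at [i] agreed it would stay strictly on
     one side. *)
  move=> [w [e [_ plane_i Sw Tw]]]; apply/negPn/negP => iST.
  have eqST : (i \in S) = (i \in T).
    by move: iST; case: (i \in S); case: (i \in T).
  have xw : dotp w x < e := Sw x Sx; have yw : e < dotp w y := Tw y Ty.
  have xyw : 0 < dotp w y - dotp w x by lra.
  pose t := (e - dotp w x) / (dotp w y - dotp w x).
  have t01 : 0 <= t <= 1.
    by apply/andP; split; rewrite ?ler_pdivrMr ?divr_ge0 //; lra.
  have : plane i (segment x y t).
    by rewrite plane_i /= dotp_segment /t divfK ?gt_eqF //; lra.
  rewrite /plane /= dotp_segment; have := Sx i; have := Ty i; rewrite -eqST.
  case: ifP => _ yi xi.
    by have := convex_comb_gt t01 xi yi; lra.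
  by have := convex_comb_lt t01 xi yi; lra.
case iS: (i \in S); case iT: (i \in T) => //= _.
  (* Here the cell of [S] lies on the positive side, so the equation is reversed to put it on the
     lower one. *)
  exists (- v i), (- d i); split; rewrite ?oppr_eq0 //.
  - by apply/seteqP; split=> z /=; rewrite /plane /= dotpNl; lra.
  - by move=> z /(_ i); rewrite iS /= dotpNl; lra.
  - by move=> z /(_ i); rewrite iT /= dotpNl; lra.
exists (v i), (d i); split=> // z /(_ i); first by rewrite iS.
by rewrite iT.
Qed.

Lemma interior_polyhedron : (forall i, v i != 0) ->
  interior [set x | forall i, dotp (v i) x <= d i] = cell finset.set0.
Proof.
move=> v0; apply/seteqP; split=> x.
  move=> /nbhs0P x_near i; rewrite inE.
  (* A small move along the normal [v i] stays in the polyhedron and increases the linear form, so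
     the inequality at [x] is strict. *)
  have /nbhs_norm0P[e /= e0 xe] := near0Z (v i) x_near.
  have e2 : 0 < e / 2 by rewrite divr_gt0.
  have le_e2 : `|e / 2| < e by rewrite gtr0_norm //; lra.
  have := xe _ le_e2 i; rewrite /= dotpDr dotpZr.
  by have := mulr_gt0 e2 (dotp_gt0 (v0 i)); lra.
(* Conversely, each strict inequality persists near [x], and there are finitely many of them. *)
move=> x0; have near_le i : \forall y \near x, dotp (v i) y <= d i.
  apply: (cvgr_le _ (@dotp_continuous _ _ (v i) x)).
  by have := x0 i; rewrite inE.
exact: (filter_forall _ near_le).
Qed.

End Cells.

(** * The faces of a cube *)

Section CubeArrangement.
Context {R : realType}.
Variables (c : 'rV[R]_3) (u : 'M[R]_3) (a : R).
Context (u_orthogonal : u *m u^T = 1%:M) (a_gt0 : 0 < a).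
Implicit Types (x y : 'rV[R]_3) (f : 'I_3 * bool).

(** The outward normal: the positive side of a face plane is the side away from the cube, so the
    sign set of a region is the set of planes separating it from the interior. *)
Definition face_normal f : 'rV[R]_3 := (-1) ^+ f.2 *: row f.1 u.

Definition face_level f : R := a + dotp (face_normal f) c.

Definition coordinate j x : R := dotp (row j u) (x - c).

Lemma dotp_face_normal f x :
  dotp (face_normal f) x - face_level f = (-1) ^+ f.2 * coordinate f.1 x - a.
Proof.
rewrite /face_level /coordinate /face_normal !dotpZl dotpDr dotpNr.
by rewrite mulrBr; lra.
Qed.

Lemma dotp_row i j : dotp (row i u) (row j u) = (i == j)%:R.
Proof.
rewrite eq_sym; have /matrixP/(_ j i) := u_orthogonal; rewrite !mxE => <-.
by rewrite dotpE; apply: eq_bigr => k _; rewrite !mxE.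
Qed.

Lemma face_normal_neq0 f : face_normal f != 0.
Proof.
rewrite scaler_eq0 signr_eq0 /=; apply/eqP => u0.
have := dotp_row f.1 f.1; rewrite u0 dotpE big1 => [|j _].
  by rewrite eqxx => /esym/eqP; rewrite oner_eq0.
by rewrite mxE mul0r.
Qed.

Lemma coordinate_point (y : 'I_3 -> R) :
  exists x, forall j, coordinate j x = y j.
Proof.
exists (\sum_j y j *: row j u + c) => j.
rewrite /coordinate addrK dotp_sumr (bigD1 j) //= dotpZr dotp_row eqxx mulr1.
rewrite big1 ?addr0 // => i ij.
by rewrite dotpZr dotp_row eq_sym (negbTE ij) mulr0.
Qed.

Lemma coordinate_affine j x y s :
  coordinate j (s *: x + (1 - s) *: y) =
  s * coordinate j x + (1 - s) * coordinate j y.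
Proof. by rewrite /coordinate !(dotpDr, dotpNr, dotpZr); ring. Qed.

Lemma cube_polyhedron :
  cube c u a = [set x | forall f, dotp (face_normal f) x <= face_level f].
Proof.
apply/seteqP; split=> x /= xP.
  move=> f; have := xP f.1; rewrite -[dotp (row f.1 u) _]/(coordinate f.1 x).
  have := dotp_face_normal f x.
  by rewrite ler_norml => + /andP[]; case: f.2; rewrite ?expr0 ?expr1; lra.
move=> j; rewrite -[dotp (row j u) _]/(coordinate j x) ler_norml.
have := xP (j, true); have := xP (j, false).
have := dotp_face_normal (j, true) x; have := dotp_face_normal (j, false) x.
by rewrite /= expr0 expr1; lra.
Qed.

Lemma affine_span_cube_face f :
  affine_span (cube_face c u a f) =
  [set x | dotp (face_normal f) x = face_level f].
Proof.
have levelP x : dotp (face_normal f) x = face_level f <->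
    coordinate f.1 x = (-1) ^+ f.2 * a.
  have := dotp_face_normal f x.
  by case: f.2; rewrite ?expr0 ?expr1 => ?; split; lra.
apply/seteqP; split=> [_ [m [x [t [xF t1 ->]]]]|x /levelP xf].
  rewrite /= dotp_sumr -[RHS]mul1r -t1 mulr_suml; apply: eq_bigr => k _.
  by rewrite dotpZr; congr (_ * _); apply/levelP; case: (xF k).
(* [x] lies on the line through the face centre [p] and a point [z] of the face,
   obtained by shrinking [x] towards [p] until it enters the cube. *)
have [p pP] := coordinate_point
  (fun j => if j == f.1 then (-1) ^+ f.2 * a else 0).
(* This choice gives t >= 1 and t a >= |coordinate j x| for all j, so shrinking by the factor 1/t
   lands in the cube. *)
pose t : R := 1 + a^-1 * \sum_j `|coordinate j x|.
have sum_ge0 (P : pred 'I_3) : 0 <= \sum_(j | P j) `|coordinate j x|.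
  exact: sumr_ge0.
have t1 : 1 <= t by rewrite lerDl mulr_ge0 ?invr_ge0 // ltW.
have t0 : 0 < t by exact: lt_le_trans t1.
pose z := t^-1 *: x + (1 - t^-1) *: p.
have zf : coordinate f.1 z = (-1) ^+ f.2 * a.
  by rewrite coordinate_affine pP eqxx xf; ring.
have cube_z : cube c u a z.
  move=> j; rewrite -[dotp (row j u) _]/(coordinate j z).
  have [->|jf] := eqVneq j f.1.
    by rewrite zf normrM normr_sign mul1r gtr0_norm.
  rewrite coordinate_affine pP (negbTE jf) mulr0 addr0 normrM.
  rewrite gtr0_norm ?invr_gt0 // ler_pdivrMl // /t mulrDl mul1r.
  rewrite mulrAC mulVf ?gt_eqF // mul1r (bigD1 j) //=.
  by have /= := sum_ge0 (fun k => k != j); have := a_gt0; lra.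
have cube_p : cube c u a p.
  move=> j; rewrite -[dotp (row j u) _]/(coordinate j p) pP.
  case: ifP => _; last by rewrite normr0 ltW.
  by rewrite normrM normr_sign mul1r gtr0_norm.
(* Solving the definition of [z] for [x] gives x = t z + (1 - t) p. *)
exists 2%N, (fun k => if k == ord0 then z else p),
  (fun k => if k == ord0 then t else 1 - t); split.
- move=> k; case: ifP => _; split=> //.
  by rewrite -[LHS]/(coordinate f.1 p) pP eqxx.
- by rewrite !big_ord_recl big_ord0 /= addr0 addrC subrK.
rewrite !big_ord_recl big_ord0 /= addr0 /z scalerDr !scalerA -addrA -scalerDl.
rewrite mulrBr mulr1 mulfV ?gt_eqF // scale1r.
have -> : t - 1 + (1 - t) = 0 by ring.
by rewrite scale0r addr0.
Qed.

(** * Regions of the cube arrangement and their labels *)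

Variable (face : 'I_6 -> 'I_3 * bool).
Context (face_bij : bijective face)
  (face_opposite : forall i j : 'I_6,
     j = (i + 3)%N :> nat -> face j = opposite_face (face i)).

Local Notation v i := (face_normal (face i)).
Local Notation d i := (face_level (face i)).
Local Notation cube_cell := (cell (fun i => v i) (fun i => d i)).

Lemma face_antipode i : face (antipode i) = opposite_face (face i).
Proof.
case: (ltnP i 3) => i3.
  by apply: face_opposite; rewrite antipodeE modn_small // (ltn_add2r 3 i 3).
(* For i >= 3 the hypothesis, which does not wrap around, is applied at the antipode; taking
   opposites is an involution. *)
have -> : face i = opposite_face (face (antipode i)).
  apply: face_opposite; rewrite antipodeE.
  by case: i i3 => [[|[|[|[|[|[|]]]]]]].
by rewrite /opposite_face /= negbK -surjective_pairing.
Qed.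

Lemma cube_cell_nonempty T : cube_cell T !=set0 <-> antipode_free T.
Proof.
split=> [[x Tx] i iT|freeT].
  (* A point beyond two opposite faces would have a coordinate both above [a] and below [-a]. *)
  apply/negP => aT; have := Tx i; have := Tx (antipode i); rewrite iT aT.
  have := dotp_face_normal (face i) x.
  have := dotp_face_normal (face (antipode i)) x.
  rewrite face_antipode /=.
  by case: (face i).2; rewrite /= ?expr0 ?expr1; have := a_gt0; lra.
case: face_bij => g gK Kg.
(* In direction j the witness has coordinate 2a or -2a if it must lie beyond a face, and 0, between
   the two faces, otherwise. *)
have [x xP] := coordinate_point (fun j =>
  2 * a * ((g (j, false) \in T)%:R - (g (j, true) \in T)%:R)).
exists x => i; rewrite -subr_gt0 -[X in if _ then _ else X]subr_lt0.
rewrite dotp_face_normal xP.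
have gi : g ((face i).1, (face i).2) = i by rewrite -surjective_pairing.
have ga : g ((face i).1, ~~ (face i).2) = antipode i.
  by rewrite -[LHS]/(g (opposite_face (face i))) -face_antipode.
have := freeT i; move: gi ga; case: (face i).2 => /= -> ->.
  case: (i \in T) => [/(_ isT)/negbTE->|_]; have := a_gt0.
    by rewrite /= expr1 ?mulr1n ?mulr0n; lra.
  by case: (antipode i \in T); rewrite /= expr1 ?mulr1n ?mulr0n; lra.
case: (i \in T) => [/(_ isT)/negbTE->|_]; have := a_gt0.
  by rewrite /= expr0 ?mulr1n ?mulr0n; lra.
by case: (antipode i \in T); rewrite /= expr0 ?mulr1n ?mulr0n; lra.
Qed.

Lemma interior_cube : interior (cube c u a) = cube_cell finset.set0.
Proof.
rewrite -interior_polyhedron => [|i]; last exact: face_normal_neq0.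
congr interior; rewrite cube_polyhedron; apply/seteqP.
split=> x /= xP i; first exact: xP.
by case: face_bij => g _ Kg; rewrite -[i]Kg.
Qed.

Lemma region_label_nonempty k : cube_cell (region_label k) !=set0.
Proof. by apply/cube_cell_nonempty/region_label_antipode_free. Qed.

Lemma region_label0 : region_label ord0 = finset.set0.
Proof. by apply/setP => i; rewrite !inE. Qed.

Lemma cell0_nonempty : cube_cell finset.set0 !=set0.
Proof. by rewrite -region_label0; exact: region_label_nonempty. Qed.

Lemma symdiff0s (T : {set 'I_6}) : symdiff finset.set0 T = T.
Proof. by rewrite /symdiff finset.set0D finset.setD0 finset.set0U. Qed.

Let cube_plane := plane (fun i => v i) (fun i => d i).

Lemma sep_cube_cell S T : cube_cell S !=set0 -> cube_cell T !=set0 ->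
  sep cube_plane (cube_cell S) (cube_cell T) = symdiff S T.
Proof. by apply: sep_cell => i; exact: face_normal_neq0. Qed.

(** Nonempty cells correspond to antipode-free sets, hence to the 27 labels; so the prescribed
    ordering of the regions does exist. *)
Lemma region_order_exists : region_order cube_plane (interior (cube c u a))
  (fun k => cube_cell (region_label k)).
Proof.
split; last 2 first.
- by rewrite interior_cube region_label0.
- move=> k; rewrite interior_cube sep_cube_cell ?symdiff0s //.
    exact: cell0_nonempty.
  exact: region_label_nonempty.
rewrite /cube_plane regionsE; split.
- by move=> k _; exists (region_label k) => //; exact: region_label_nonempty.
- move=> k l _ _ eq_kl; apply: region_label_inj.
  have [x xk] := region_label_nonempty k.
  rewrite -(cell_sign_set xk); rewrite eq_kl in xk.
  exact: cell_sign_set xk.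
- move=> _ [T /cube_cell_nonempty/region_label_surj[k <-] <-].
  by exists k.
Qed.

(** Each region is the cell of some [T], and separation from the central cell recovers [T]; the
    labelling condition thus determines [r]. *)
Lemma region_order_cell r : region_order cube_plane (interior (cube c u a)) r ->
  forall k, r k = cube_cell (region_label k).
Proof.
move=> [[r_regions _ _] _ r_sep] k.
have := r_regions k I; rewrite /cube_plane regionsE => -[T T0 rk].
have := r_sep k; rewrite interior_cube -rk sep_cube_cell //.
  by rewrite symdiff0s => ->.
exact: cell0_nonempty.
Qed.

End CubeArrangement.

Theorem mainTheorem7 (R : realType) (c : 'rV[R]_3) (u : 'M[R]_3) (a : R)
    (u_orthogonal : u *m u^T = 1%:M) (a_gt0 : 0 < a)
    (h : 'I_6 -> set 'rV[R]_3) (h_cube : cube_arrangement c u a h) :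
  (exists r : 'I_27 -> set 'rV[R]_3, region_order h (interior (cube c u a)) r) /\
  (forall r : 'I_27 -> set 'rV[R]_3, region_order h (interior (cube c u a)) r ->
     smith_normal_form (varchenko_mx h r)
       diagonal_form transition_mx transition_mx^T).
Proof.
have [f [f_bij hE f_opp]] := h_cube.
(* The affine spans of the faces are replaced by the equations with outward normals. *)
have -> : h = plane (fun i => face_normal u (f i))
                    (fun i => face_level c u a (f i)).
  by apply/funext => i; rewrite hE affine_span_cube_face.
split; first by eexists; exact: region_order_exists.
move=> r /region_order_cell rE; apply: smith_normal_form_label => k l.
rewrite mxE !rE // sep_cube_cell //; exact: region_label_nonempty.
Qed.
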